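(* Let $A$ be a finite non-empty subset of a commutative group $G$ and let $K$ be a real number. If $|A+A|\leq K|A|$, then $|A+2\cdot A|\leq (K|A|)^{4/3}$.
   Context: The group $G$ is written additively. $A+A=\{a+a' : a,a'\in A\}$ and $A+2\cdot A=\{a+a'+a' : a,a'\in A\}$. *)

(* Defs.v *)
From HB Require Import structures.
From mathcomp Require Import all_boot all_order all_algebra finmap.
From mathcomp Require Import reals exp.

Set Implicit Arguments.
Unset Strict Implicit.
Unset Printing Implicit Defensive.

Import Order.TTheory GRing.Theory Num.Theory.

Local Open Scope fset_scope.
Local Open Scope ring_scope.

Definition sumset (G : zmodType) (A B : {fset G}) : {fset G} :=
  [fset a + b | a in A, b in B].

(* The set A + 2.A, where 2.A = {a' + a' : a' in A} is the dilate of A by 2, as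
   opposed to the sumset A + A. *)
Definition sum_dilate2 (G : zmodType) (A : {fset G}) : {fset G} :=
  [fset a + a' + a' | a in A, a' in A].

(* Main.v *)
Require Import Defs.
From HB Require Import structures.
From mathcomp Require Import all_boot all_order all_algebra finmap.
From mathcomp Require Import reals exp.
From mathcomp Require Import zify.

Set Implicit Arguments.
Unset Strict Implicit.
Unset Printing Implicit Defensive.

Import Order.TTheory GRing.Theory Num.Theory.

Local Open Scope fset_scope.
Local Open Scope ring_scope.

(** Write S for |A + A| and N for |A + 2.A|; the inequality to prove is
    N^3 <= S^4, a statement about natural numbers, and the real exponent is
    only introduced in the last proof.

    Suppose B is a subset of A for which B + A + A is small. An element
    z = x + y + y with x or y in B lies in B + A + A, so the remaining elements
    of A + 2.A come from pairs in (A \ B)^2. If A \ B has fewer than about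
    sqrt N elements these pairs produce at most half of A + 2.A, and then
    N <= 2 |B + A + A|. It remains to find such a B with |B + A + A| of order
    S^2 / sqrt N, for this gives N^(3/2) <= C S^2.

    The set B is built by exhaustion. From what is left, R = A \ B, take the
    nonempty X that minimizes |X + A| / |X|. By Petridis's inequality
    |X + A + A| <= (|X + A| / |X|)^2 |X|, and by minimality the ratio is at most
    |R + A| / |R| <= S / |R|. Moving X into B thus raises |B + A + A| by at most
    S^2 |X| / |R|^2, no more than the growth of S^2 / |A \ B|, so the bound
    |B + A + A| <= S^2 / |A \ B| persists until |A \ B| falls below sqrt N.

    This yields N^3 <= 32 S^4 in every commutative group. Passing from A to
    A * A in G * G squares both N and S while the constant stays the same, so
    it can be removed: this is the tensor power trick. *)

(** * Sumsets and dilates as finite sets *)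

Lemma sumsetP (G : zmodType) (A B : {fset G}) (x : G) :
  reflect (exists2 a, a \in A & exists2 b, b \in B & x = a + b)
          (x \in sumset A B).
Proof.
apply: (iffP (imfset2P _ _ _ _ _)) => -[a aA [b bB xE]];
  by exists a => //; exists b.
Qed.

Lemma mem_sumset (G : zmodType) (A B : {fset G}) (a b : G) :
  a \in A -> b \in B -> a + b \in sumset A B.
Proof. by move=> aA bB; apply/sumsetP; exists a => //; exists b. Qed.

Lemma sum_dilate2P (G : zmodType) (A : {fset G}) (x : G) :
  reflect (exists2 a, a \in A & exists2 b, b \in A & x = a + b + b)
          (x \in sum_dilate2 A).
Proof.
apply: (iffP (imfset2P _ _ _ _ _)) => -[a aA [b bB xE]];
  by exists a => //; exists b.
Qed.

Lemma mem_sum_dilate2 (G : zmodType) (A : {fset G}) (a b : G) :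
  a \in A -> b \in A -> a + b + b \in sum_dilate2 A.
Proof. by move=> aA bA; apply/sum_dilate2P; exists a => //; exists b. Qed.

Lemma sumset0l (G : zmodType) (A : {fset G}) : sumset fset0 A = fset0.
Proof. by apply/fsetP => x; rewrite inE; apply/sumsetP => -[]. Qed.

Lemma sumset0r (G : zmodType) (A : {fset G}) : sumset A fset0 = fset0.
Proof. by apply/fsetP => x; rewrite inE; apply/sumsetP => -[a _ []]. Qed.

Lemma sumsetS (G : zmodType) (A A' B B' : {fset G}) :
  A `<=` A' -> B `<=` B' -> sumset A B `<=` sumset A' B'.
Proof.
move=> /fsubsetP sA /fsubsetP sB; apply/fsubsetP => x /sumsetP[a aA [b bB ->]].
by apply: mem_sumset; [apply: sA | apply: sB].
Qed.

Lemma sumsetUl (G : zmodType) (A A' B : {fset G}) :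
  sumset (A `|` A') B = sumset A B `|` sumset A' B.
Proof.
apply/fsetP => x; rewrite in_fsetU; apply/sumsetP/orP.
  by move=> [a /fsetUP[] aA [b bB ->]]; [left | right]; apply: mem_sumset.
by move=> [] /sumsetP[a aA [b bB ->]]; exists a;
  rewrite ?in_fsetU ?aA ?orbT //; exists b.
Qed.

Lemma card_translate (G : zmodType) (A : {fset G}) (c : G) :
  #|` [fset a + c | a in A]| = #|` A|.
Proof. by apply: card_imfset => x y /addIr. Qed.

Lemma cardfsU_le (T : choiceType) (A B : {fset T}) :
  (#|` A `|` B| <= #|` A| + #|` B|)%N.
Proof. by rewrite -cardfsUI leq_addr. Qed.

Lemma card_fsetM (T T' : choiceType) (A : {fset T}) (B : {fset T'}) :
  #|` A `*` B| = (#|` A| * #|` B|)%N.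
Proof.
rewrite -(size_allpairs (@pair T T')); apply/perm_size/uniq_perm => //.
  by apply: allpairs_uniq => // -[? ?] -[? ?].
move=> [a b]; rewrite in_fsetM /=; apply/andP/allpairsP => [[aA bB]|].
  by exists (a, b).
by move=> [[x y]] [/= xA yB [-> ->]].
Qed.

Lemma card_sum_dilate2_le (G : zmodType) (A : {fset G}) :
  (#|` sum_dilate2 A| <= #|` A| ^ 2)%N.
Proof.
have -> : sum_dilate2 A = [fset p.1 + p.2 + p.2 | p in A `*` A].
  apply/fsetP => x; apply/sum_dilate2P/imfsetP => /=.
    by move=> [a aA [b bA ->]]; exists (a, b); rewrite //= in_fsetM aA.
  by move=> [[a b]]; rewrite in_fsetM => /andP[aA bA] ->; exists a => //; exists b.
by rewrite (leq_trans (leq_imfset_card _ _ _)) //= card_fsetM expnS expn1.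
Qed.

(** * Petridis's inequality and the exhaustion of A *)

(** Add the elements of C one at a time. The new element
    c contributes to X + A + C at most |X + A| - |Y + A| points, where Y is the
    set of x in X with x + A + c already covered; it contributes to X + C at
    least |X| - |Y| points, since x + c in X + C forces x in Y. Minimality of
    the ratio at X, applied to Y, compares the two increments. *)
Lemma petridis_inequality (G : zmodType) (X A C : {fset G}) :
    (forall Y, Y `<=` X ->
      (#|` sumset X A| * #|` Y| <= #|` sumset Y A| * #|` X|)%N) ->
  (#|` sumset (sumset X A) C| * #|` X| <= #|` sumset X A| * #|` sumset X C|)%N.
Proof.
move=> minX; elim/fset1U_rect: C => [|c C cC IH].
  by rewrite !sumset0r cardfs0.
set Z := sumset (sumset X A) C in IH *.
pose Y := [fset x in X | all (fun a => x + a + c \in Z) A].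
have YP x : reflect (x \in X /\ forall a, a \in A -> x + a + c \in Z) (x \in Y).
  by rewrite !inE; apply: (iffP andP) => -[xX /allP xZ].
have sYX : Y `<=` X by apply/fsubsetP => x /YP[].
have sYXA : sumset Y A `<=` sumset X A by apply: sumsetS.
have ub : (#|` sumset (sumset X A) (c |` C)| <=
           #|` Z| + (#|` sumset X A| - #|` sumset Y A|))%N.
  pose U := [fset a + c | a in sumset X A `\` sumset Y A].
  have -> : (#|` sumset X A| - #|` sumset Y A|)%N = #|` U|.
    by rewrite card_translate cardfsDS.
  apply: leq_trans (cardfsU_le _ _); apply: fsubset_leq_card.
  apply/fsubsetP => u /sumsetP[w wXA [d]].
  rewrite in_fset1U => /orP[/eqP -> | dC] ->; last first.
    by rewrite in_fsetU mem_sumset.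
  rewrite in_fsetU; have [/sumsetP[y yY [a aA ->]]|wYA] := boolP (w \in sumset Y A).
    by case/YP: yY => _ /(_ a aA) ->.
  by apply/orP; right; apply/imfsetP; exists w => //=; rewrite in_fsetD wYA.
have lb : (#|` sumset X C| + (#|` X| - #|` Y|) <= #|` sumset X (c |` C)|)%N.
  pose V := [fset a + c | a in X `\` Y].
  have -> : (#|` X| - #|` Y|)%N = #|` V| by rewrite card_translate cardfsDS.
  have dis : sumset X C `&` V = fset0.
    apply/fsetP => u; rewrite in_fsetI in_fset0; apply/negP => /andP[uXC].
    case/imfsetP => /= x; rewrite in_fsetD => /andP[/negP xY xX] uE; apply: xY.
    apply/YP; split=> // a aA; case/sumsetP: uXC => x' x'X [d dC].
    rewrite uE => xcE; rewrite addrAC xcE addrAC.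
    by apply: mem_sumset => //; apply: mem_sumset.
  rewrite -cardfsUI dis cardfs0 addn0; apply: fsubset_leq_card.
  apply/fsubsetP => u; rewrite in_fsetU => /orP[/sumsetP[x xX [d dC ->]]|].
    by rewrite mem_sumset // in_fset1U dC orbT.
  case/imfsetP => /= x; rewrite in_fsetD => /andP[_ xX] ->.
  by rewrite mem_sumset // fset1U1.
have leYX := fsubset_leq_card sYX.
have leYXA := fsubset_leq_card sYXA.
have := minX _ sYX.
move: ub lb leYX leYXA IH; move: #|` _| => a; move: #|` Z| => z.
move: #|` sumset X A| #|` sumset Y A| #|` sumset X C| => xa ya xc.
move: #|` sumset X _| #|` X| #|` Y| => xc' x y.
nia.
Qed.

(** The ratios |X + A| / |X| are compared by cross-multiplication; minimality is
    claimed only among subsets of X, which is what Petridis's inequality uses.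
    Either R itself is minimal, or a proper subset has a smaller ratio and the
    induction continues inside it. *)
Lemma exists_ratio_minimizer (G : zmodType) (A R : {fset G}) : R != fset0 ->
  exists X, [/\ X `<=` R, X != fset0,
    (#|` sumset X A| * #|` R| <= #|` sumset R A| * #|` X|)%N &
    forall Y, Y `<=` X ->
      (#|` sumset X A| * #|` Y| <= #|` sumset Y A| * #|` X|)%N].
Proof.
elim/finSet_rect: R => R IH R0.
pose P (Y : {fset G}) := (#|` sumset R A| * #|` Y| <= #|` sumset Y A| * #|` R|)%N.
have [minR|] := boolP (all P (fpowerset R)).
  exists R; split=> // Y sYR.
  by apply: (allP minR Y); rewrite fpowersetE.
case/allPn => Y; rewrite fpowersetE /P -ltnNge => sYR ltY.
have Y0 : Y != fset0 by apply: contraTneq ltY => ->; rewrite cardfs0 muln0.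
have ltYR : Y `<` R.
  rewrite fproperEneq sYR andbT; apply: contraTneq ltY => ->.
  by rewrite ltnn.
have [X [sXY X0 leX minX]] := IH Y ltYR Y0.
exists X; split => //; first exact: fsubset_trans sXY sYR.
rewrite -(leq_pmul2r (_ : 0 < #|` Y|)%N) ?cardfs_gt0 //.
move: leX ltY; nia.
Qed.

(** Petridis's inequality with C = A, for a ratio |X + A| / |X| at most
    |A + A| / |R|. *)
Lemma exists_small_tripling (G : zmodType) (A R : {fset G}) :
    R != fset0 -> R `<=` A ->
  exists X, [/\ X `<=` R, X != fset0 &
    (#|` sumset (sumset X A) A| * #|` R| ^ 2 <=
     #|` sumset A A| ^ 2 * #|` X|)%N].
Proof.
move=> R0 sRA; have [X [sXR X0 leX minX]] := exists_ratio_minimizer A R0.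
exists X; split => //.
have := petridis_inequality A minX.
have leRA : (#|` sumset R A| <= #|` sumset A A|)%N.
  exact/fsubset_leq_card/sumsetS.
have leXS : (#|` sumset X A| * #|` R| <= #|` sumset A A| * #|` X|)%N.
  by apply: leq_trans leX _; rewrite leq_mul2r leRA orbT.
have x_gt0 : (0 < #|` X|)%N by rewrite cardfs_gt0.
move=> H; rewrite -(leq_pmul2r x_gt0).
have := leq_mul leXS leXS.
move: H; move: #|` sumset X A| #|` sumset (sumset X A) A| => xa xaa.
move: #|` X| #|` R| #|` sumset A A| => x r s.
move=> /(leq_mul (leqnn (r ^ 2))) H1 H2.
apply: leq_trans (_ : xaa * x * r ^ 2 <= _)%N; first by rewrite mulnAC.
rewrite mulnC; apply: leq_trans H1 _.
apply: leq_trans (_ : xa * r * (xa * r) <= _)%N; first by lia.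
by apply: leq_trans H2 _; lia.
Qed.

(** The invariant is |B + A + A| * |A \ B| <= S^2. Moving X from the remainder R
    to B keeps it, because
      S^2 / |R| + S^2 |X| / |R|^2 <= S^2 / (|R| - |X|),
    that is (|R| + |X|) (|R| - |X|) <= |R|^2. The process stops when the
    remainder is small compared with sqrt n. The last X may be all of R, so the
    final estimate involves r, the size of the remainder just before the last
    step, and costs a factor 2. *)
Lemma exists_exhausting_subset (G : zmodType) (A : {fset G}) (n : nat) :
    (0 < n <= 2 * #|` A| ^ 2)%N ->
  exists2 B, B `<=` A & exists r, [/\ (2 * #|` A `\` B| ^ 2 < n)%N,
    (n <= 2 * r ^ 2)%N &
    (#|` sumset (sumset B A) A| * r <= 2 * #|` sumset A A| ^ 2)%N].
Proof.
move=> /andP[n_gt0 leA]; set s := #|` sumset A A|.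
(* m bounds the size of the remainder and drives the induction. *)
suff step m B : B `<=` A -> (#|` A `\` B| <= m)%N ->
    (n <= 2 * #|` A `\` B| ^ 2)%N ->
    (#|` sumset (sumset B A) A| * #|` A `\` B| <= s ^ 2)%N ->
  exists2 B, B `<=` A & exists r, [/\ (2 * #|` A `\` B| ^ 2 < n)%N,
    (n <= 2 * r ^ 2)%N & (#|` sumset (sumset B A) A| * r <= 2 * s ^ 2)%N].
  apply: (step #|` A| fset0); rewrite ?fsub0set ?fsetD0 //.
  by rewrite !sumset0l cardfs0.
elim: m B => [|m IH] B sBA.
  rewrite leqn0 => /eqP -> /(leq_trans n_gt0); lia.
set R := A `\` B => leR ler inv.
have R0 : R != fset0.
  by apply: contraTneq ler => ->; rewrite cardfs0 -ltnNge.
have [X [sXR X0]] := exists_small_tripling R0 (fsubsetDl _ _).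
rewrite -/s => leX.
have sXA : X `<=` A := fsubset_trans sXR (fsubsetDl _ _).
have cardD : #|` A `\` (B `|` X)| = (#|` R| - #|` X|)%N.
  by rewrite -fsetDDl cardfsDS.
have leXR := fsubset_leq_card sXR.
have x_gt0 : (0 < #|` X|)%N by rewrite cardfs_gt0.
have r_gt0 : (0 < #|` R|)%N by rewrite cardfs_gt0.
have leU : (#|` sumset (sumset (B `|` X) A) A| * #|` R| ^ 2 <=
            s ^ 2 * (#|` R| + #|` X|))%N.
  rewrite !sumsetUl; have := cardfsU_le (sumset (sumset B A) A)
    (sumset (sumset X A) A).
  move: inv leX; move: #|` _| => u; nia.
have sUA : B `|` X `<=` A by rewrite fsubUset sBA.
have [stop|go] := ltnP (2 * #|` A `\` (B `|` X)| ^ 2) n.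
  exists (B `|` X) => //; exists #|` R|; split => //.
  nia.
apply: (IH (B `|` X)) => //.
  by rewrite cardD; lia.
rewrite cardD; nia.
Qed.

(** With B exhausting A up to about sqrt (n / 2) elements, the pairs in
    (A \ B)^2 give fewer than n / 2 elements, whence n < 2 |B + A + A|,
    n r <= 4 S^2, and finally n^3 <= 2 (n r)^2 <= 32 S^4. *)
Lemma sum_dilate2_weak_bound (G : zmodType) (A : {fset G}) :
  (#|` sum_dilate2 A| ^ 3 <= 32 * #|` sumset A A| ^ 4)%N.
Proof.
set n := #|` sum_dilate2 A|; set s := #|` sumset A A|.
have [->|n_gt0] := posnP n; first by rewrite exp0n.
have n_le : (n <= #|` A| ^ 2)%N := card_sum_dilate2_le A.
have [B sBA [r [small large triple]]] : exists2 B, B `<=` A &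
    exists r, [/\ (2 * #|` A `\` B| ^ 2 < n)%N, (n <= 2 * r ^ 2)%N &
    (#|` sumset (sumset B A) A| * r <= 2 * s ^ 2)%N].
  by apply: exists_exhausting_subset; rewrite n_gt0 (leq_trans n_le) // leq_pmull.
have cover : sum_dilate2 A `<=`
    sumset (sumset B A) A `|` sum_dilate2 (A `\` B).
  apply/fsubsetP => _ /sum_dilate2P[x xA [y yA ->]]; rewrite in_fsetU.
  have [xB|xB] := boolP (x \in B); first by rewrite !mem_sumset.
  have [yB|yB] := boolP (y \in B).
    (* x + y + y is read as y + x + y. *)
    by rewrite (addrC x) !mem_sumset.
  by rewrite mem_sum_dilate2 ?orbT // in_fsetD ?xB ?yB.
have := leq_trans (fsubset_leq_card cover) (cardfsU_le _ _).
have := card_sum_dilate2_le (A `\` B); rewrite -/n.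
move: small large triple; move: #|` _| => t; move: #|` _| => b.
move: #|` _| => d small large triple d_le n_le'.
have ltn : (n < 2 * b)%N by lia.
have nr : (n * r <= 4 * s ^ 2)%N by nia.
have := leq_mul nr nr; have : (n * (n * n) <= n * n * (2 * r ^ 2))%N by nia.
nia.
Qed.

(** * Removing the constant *)

Lemma sumset_fsetM (G G' : zmodType) (A : {fset G}) (A' : {fset G'}) :
  sumset (A `*` A') (A `*` A') = sumset A A `*` sumset A' A'.
Proof.
apply/fsetP => -[x x']; rewrite in_fsetM /=; apply/sumsetP/andP.
  move=> [[a a']]; rewrite in_fsetM => /andP[/= aA aA'] [[b b']].
  rewrite in_fsetM => /andP[/= bA bA'] [-> ->].
  by split; apply: mem_sumset.
move=> [/sumsetP[a aA [b bA ->]] /sumsetP[a' aA' [b' bA' ->]]].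
by exists (a, a'); rewrite ?in_fsetM ?aA //; exists (b, b'); rewrite ?in_fsetM ?bA.
Qed.

Lemma sum_dilate2_fsetM (G G' : zmodType) (A : {fset G}) (A' : {fset G'}) :
  sum_dilate2 (A `*` A') = sum_dilate2 A `*` sum_dilate2 A'.
Proof.
apply/fsetP => -[x x']; rewrite in_fsetM /=; apply/sum_dilate2P/andP.
  move=> [[a a']]; rewrite in_fsetM => /andP[/= aA aA'] [[b b']].
  rewrite in_fsetM => /andP[/= bA bA'] [-> ->].
  by split; apply: mem_sum_dilate2.
move=> [/sum_dilate2P[a aA [b bA ->]] /sum_dilate2P[a' aA' [b' bA' ->]]].
by exists (a, a'); rewrite ?in_fsetM ?aA //; exists (b, b'); rewrite ?in_fsetM ?bA.
Qed.

(** The induction applies the hypothesis to A * A, hence quantifies over all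
    groups: A is replaced by its (2 ^ j)-th Cartesian power. *)
Lemma sum_dilate2_bound_expn (j : nat) (G : zmodType) (A : {fset G}) :
  ((#|` sum_dilate2 A| ^ 3) ^ (2 ^ j) <=
   32 * (#|` sumset A A| ^ 4) ^ (2 ^ j))%N.
Proof.
elim: j G A => [|j IH] G A; first by rewrite expn0 !expn1 sum_dilate2_weak_bound.
have := IH _ (A `*` A).
rewrite sum_dilate2_fsetM sumset_fsetM !card_fsetM !mulnn.
by rewrite (expnS 2 j) !(expnM _ 2) -!(expnM _ 2 3) -!(expnM _ 2 4)
  (mulnC 2 3) (mulnC 2 4) !expnM.
Qed.

(** If a >= b + 1, Bernoulli's inequality makes (a / b) ^ (2 ^ j) unbounded. *)
Lemma leq_of_expn_leq (c a b : nat) :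
  (forall j, a ^ (2 ^ j) <= c * b ^ (2 ^ j))%N -> (a <= b)%N.
Proof.
move=> H; rewrite leqNgt; apply/negP => ltba.
(* (1 + 1 / b) ^ m >= 1 + m / b, with denominators cleared. *)
have bernoulli m : (b ^ m * (b + m) <= b * b.+1 ^ m)%N.
  elim: m => [|m IH]; first by rewrite !expn0 addn0 mul1n muln1.
  have := leq_mul (leqnn b.+1) IH; rewrite !expnS; nia.
have [b0|b_gt0] := posnP b.
  by have := H 0%N; rewrite b0 expn0 !expn1 muln0; lia.
(* Bernoulli at m = 2 ^ j gives b + m <= c b, while m > j. *)
pose j := (c * b)%N.
have := H j; have := bernoulli (2 ^ j)%N.
have : (b.+1 ^ (2 ^ j) <= a ^ (2 ^ j))%N by rewrite leq_exp2r ?expn_gt0.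
have : (j < 2 ^ j)%N by rewrite ltn_expl.
have : (0 < b ^ (2 ^ j))%N by rewrite expn_gt0 b_gt0.
rewrite /j; move: (2 ^ _)%N => m; move: (b ^ m)%N (b.+1 ^ m)%N (a ^ m)%N => u v w.
move=> u_gt0 lt_m le_vw bern le_w.
have : (u * (b + m) <= b * (c * u))%N.
  by apply: leq_trans bern _; rewrite leq_mul2l (leq_trans le_vw le_w) orbT.
nia.
Qed.

Lemma sum_dilate2_bound (G : zmodType) (A : {fset G}) :
  (#|` sum_dilate2 A| ^ 3 <= #|` sumset A A| ^ 4)%N.
Proof.
by apply: (leq_of_expn_leq (c := 32)) => j; apply: sum_dilate2_bound_expn.
Qed.

Theorem theorem15 (G : zmodType) (R : realType) (A : {fset G}) (K : R)
    (hA : A != fset0)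
    (hK : #|` sumset A A|%:R <= K * #|` A|%:R) :
  #|` sum_dilate2 A|%:R <= (K * #|` A|%:R) `^ (4 / 3).
Proof.
have KA_ge0 : 0 <= K * #|` A|%:R := le_trans (ler0n R _) hK.
set n := #|` sum_dilate2 A|; set k := K * _ in hK KA_ge0 *.
have n3_le : (n%:R : R) ^+ 3 <= k ^+ 4.
  apply: (le_trans (_ : _ <= (#|` sumset A A|%:R : R) ^+ 4)).
    by rewrite -!natrX ler_nat sum_dilate2_bound.
  by rewrite lerXn2r ?nnegrE.
have -> : (n%:R : R) = (n%:R ^+ 3) `^ 3^-1.
  by rewrite -powR_mulrn // -powRrM divff ?pnatr_eq0 // powRr1.
rewrite powRrM powR_mulrn //.
by apply: ge0_ler_powR; rewrite ?nnegrE ?exprn_ge0 ?invr_ge0.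
Qed.
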